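(* Let $m>2$ be an integer and let $L>0$. Choose $p_1,p_2,\dots,p_{m-1}\in(0,1)$ such that $p_1+p_2+\cdots+p_{m-1}<1$, and set $p_m:=1-(p_1+p_2+\cdots+p_{m-1})$. Start with a stick of length $L$. At each stage, cut every existing stick according to the proportions $p_1,p_2,\dots,p_{m-1}$ to create $m$ pieces (a stick of length $\ell$ is replaced by $m$ sticks of lengths $p_1\ell,p_2\ell,\dots,p_m\ell$). After $N$ iterations there are $m^N$ sticks in total, of lengths $$A_{k_1,k_2,\dots,k_m}:=L\,p_1^{k_1}p_2^{k_2}\cdots p_m^{k_m},$$ for integers $0\le k_1,k_2,\dots,k_m\le N$ with $k_1+k_2+\cdots+k_m=N$, the length $A_{k_1,\dots,k_m}$ being counted with multiplicity $\frac{N!}{k_1!k_2!\cdots k_m!}$. Let $y_i=\log_{10}(p_i/p_{i+1})$ for $1\le i\le m-1$. Then the stick fragmentation model results in stick lengths that converge (as $N\to\infty$) to strong Benford's law if and only if $y_i\notin\mathbb{Q}$ for some $1\le i\le m-1$.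
   Context: Every real $x>0$ can be written uniquely as $x=S_{10}(x)\cdot 10^{k_{10}(x)}$ with $S_{10}(x)\in[1,10)$ and $k_{10}(x)\in\mathbb{Z}$; $S_{10}(x)$ is called the (base 10) significand of $x$. A sequence of positive random variables $\{X^{(N)}\}_{N=1}^\infty$ converges to strong Benford's law if $\lim_{N\to\infty}\mathbb{P}(S_{10}(X^{(N)})\le s)=\log_{10}(s)$ for all $s\in[1,10]$. The stick lengths of the fragmentation model are said to converge to strong Benford's law if this holds with $X^{(N)}$ the length of a stick chosen uniformly at random from the $m^N$ sticks present after $N$ stages (sticks counted with multiplicity). That is, $X^{(N)}=L\,p_1^{k_1}\cdots p_m^{k_m}$, where $(k_1,\dots,k_m)$ is a vector of nonnegative integers summing to $N$, chosen with probability $\frac{1}{m^N}\cdot\frac{N!}{k_1!k_2!\cdots k_m!}$. *)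

(* Defs.v *)
From HB Require Import structures.
From mathcomp Require Import all_boot all_order all_algebra.
From mathcomp Require Import all_classical all_reals all_analysis.
From mathcomp Require Import zify.
Set Implicit Arguments.
Unset Strict Implicit.
Unset Printing Implicit Defensive.
Import Order.TTheory GRing.Theory Num.Theory.
Import numFieldNormedType.Exports.
Local Open Scope classical_set_scope.
Local Open Scope ring_scope.

Definition log10 {R : realType} (x : R) : R := ln x / ln 10.

Definition is_significand {R : realType} (x s : R) : Prop :=
  1 <= s < 10 /\ exists k : int, x = s * 10 ^ k.

(* Equal to 0 when x <= 0, where no significand exists. *)
Definition significand {R : realType} (x : R) : R :=
  xget 0 [set s | is_significand x s].

Lemma is_significand_uniq (R : realType) (x s t : R) :
  is_significand x s -> is_significand x t -> s = t.
Proof.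
move=> [/andP[s1 s10] [k ->]] [/andP[t1 t10] [l]].
wlog kl : s t k l s1 s10 t1 t10 / k <= l.
  move=> H e; case/orP: (le_total k l) => kl; first exact: (H s t k l).
  by apply/esym; apply: (H t s l k) => //.
have [n ->] : exists n : nat, l = k + n%:Z by exists `|l - k|%N; lia.
have k0 : (10 : R) ^ k != 0 by rewrite expfz_neq0// pnatr_eq0.
rewrite expfzDr ?pnatr_eq0// mulrCA mulrC => /(mulfI k0); rewrite -exprnP.
case: n => [|n]; first by rewrite expr0 mulr1.
move=> e; suff : 10 <= s by rewrite leNgt s10.
rewrite e exprS mulrCA ler_peMr// mulr_ege1 ?exprn_ege1 ?ler1n//.
Qed.

Lemma significandP (R : realType) (x : R) :
  0 < x -> is_significand x (significand x).
Proof.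
move=> x0; apply: (@xgetPex _ 0 [set s | is_significand x s]).
have l0 : 0 < ln (10 : R) by rewrite ln_gt0// ltr1n.
set k := Num.floor (log10 x).
have e k' : expR (k'%:~R * ln 10) = 10 ^ k' :> R.
  by rewrite -powR_intmul ?ler0n// /powR pnatr_eq0.
have p0 k' : 0 < 10 ^ k' :> R by rewrite exprz_gt0// ltr0n.
exists (x / 10 ^ k) => /=; split; last by exists k; rewrite divfK// gt_eqF.
have xE : x = expR (log10 x * ln 10) by rewrite /log10 divfK ?gt_eqF// lnK.
have xge : 10 ^ k <= x.
  by rewrite -e xE ler_expR ler_pM2r// floor_le.
have xlt : x < 10 ^ (k + 1) by rewrite -e xE ltr_expR ltr_pM2r// floorD1_gt.
rewrite expfzDr ?pnatr_eq0// expr1z in xlt.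
by rewrite ler_pdivlMr ?ltr_pdivrMr// mul1r xge mulrC.
Qed.

(* Convergence in law only, so each X N may live on its own probability space.
   The notion is meant for positive X N. *)
Definition strong_benford {R : realType} (d : nat -> measure_display)
    (T : forall N, measurableType (d N)) (P : forall N, probability (T N) R)
    (X : forall N, {RV (P N) >-> R}) : Prop :=
  forall s : R, 1 <= s <= 10 ->
    (fun N => P N [set w | significand (X N w) <= s]) @ \oo --> (log10 s)%:E.

(* Proportions are indexed from 1 to m; values of p elsewhere are irrelevant. *)
Definition cut {R : realType} (m : nat) (p : nat -> R) (sticks : seq R) : seq R :=
  [seq p i * l | l <- sticks, i <- iota 1 m].

Definition stick_lengths {R : realType} (m : nat) (p : nat -> R) (L : R)
    (N : nat) : seq R := iter N (cut m p) [:: L].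

(* The uniform distribution on {0, ..., n - 1}, for n > 0 (see uniform_natE). *)
Definition uniform_nat (R : realType) (n : nat) : probability nat R :=
  mnormalize (msum (fun i : nat => dirac i) n) (dirac 0%N).

Definition stick_length_at {R : realType} (m : nat) (p : nat -> R) (L : R)
    (N : nat) (j : nat) : R := nth L (stick_lengths m p L N) j.

HB.instance Definition _ (R : realType) (m : nat) (p : nat -> R) (L : R)
    (N : nat) := isMeasurableFun.Build _ _ nat R (stick_length_at m p L N)
  (fun _ _ _ => I).

Definition random_stick {R : realType} (m : nat) (p : nat -> R) (L : R)
    (N : nat) : {RV (uniform_nat R (m ^ N)) >-> R} := stick_length_at m p L N.

Lemma uniform_natE (R : realType) (n : nat) (A : set nat) : (0 < n)%N ->
  uniform_nat R n A = ((\sum_(i < n) (val i \in A))%:R / n%:R)%:E.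
Proof.
move=> n0; have mE B : msum (fun i : nat => @dirac _ nat i R) n B =
    ((\sum_(i < n) (val i \in B))%N%:R)%:E.
  by rewrite /msum natr_sum -sumEFin.
have mT : msum (fun i : nat => @dirac _ nat i R) n setT = n%:R%:E.
  by rewrite mE; under eq_bigr do rewrite in_setT; rewrite sum1_card card_ord.
rewrite /uniform_nat /= /mnormalize.
rewrite [X in fine X](mT : _ = _) [X in X == 0%E](mT : _ = _) [X in X == +oo%E](mT : _ = _).
by rewrite /= eqe pnatr_eq0 (gtn_eqF n0) /= (mE A : _ = _) EFinM.
Qed.

Lemma size_stick_lengths (R : realType) m (p : nat -> R) L N :
  size (stick_lengths m p L N) = (m ^ N)%N.
Proof.
elim: N => //= N IH.
by rewrite size_allpairs -/(stick_lengths _ _ _ _) IH size_iota expnSr.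
Qed.

Lemma random_stick_gt0 (R : realType) m (p : nat -> R) L N w :
  0 < L -> (forall i, (1 <= i <= m)%N -> 0 < p i) -> 0 < random_stick m p L N w.
Proof.
move=> L0 p0; have H : {in stick_lengths m p L N, forall l, 0 < l}.
  elim: N => [|N IH] l; first by rewrite inE => /eqP->.
  move=> /allpairsP[[l' i]] /= [l'N]; rewrite mem_iota => im ->.
  by apply: mulr_gt0; [apply: p0; lia|exact: IH].
rewrite /random_stick /= /stick_length_at.
have [wN|wN] := ltnP w (size (stick_lengths m p L N)); first by apply/H/mem_nth.
by rewrite nth_default.
Qed.

Lemma count_cut (R : realType) m (p : nat -> R) (s : seq R) (a : pred R) :
  count a (cut m p s) = (\sum_(i < m) count (fun l => a (p i.+1 * l)%R) s)%N.
Proof.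
elim: s => [|x s IH]; first by rewrite big1.
rewrite /cut allpairs_cons count_cat -/(cut m p s) IH count_map /=.
rewrite big_split /=; congr (_ + _)%N.
rewrite -sum1_count big_mkcond /=.
have -> : iota 1 m = index_iota 1 m.+1 by rewrite /index_iota subn1.
by rewrite big_add1 /= big_mkord; apply: eq_bigr => i _; case: ifP.
Qed.

Lemma dvdn_prod_fact (I : Type) (r : seq I) (f : I -> nat) :
  (\prod_(i <- r) (f i)`! %| (\sum_(i <- r) f i)`!)%N.
Proof.
elim: r => [|i r IH]; first by rewrite !big_nil.
rewrite !big_cons -(bin_fact (leq_addr _ (f i))) addKn dvdn_mull//.
exact: dvdn_mul.
Qed.

Lemma count_stick_lengths_bound (R : realType) m (p : nat -> R) (L : R) B N
    (a : pred R) : (N <= B)%N ->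
  count a (stick_lengths m p L N) =
  (\sum_(k : {ffun 'I_m -> 'I_B.+1} | \sum_i k i == N)
     (N`! %/ \prod_i (k i)`!) * a (L * \prod_(i < m) p i.+1 ^+ k i)%R)%N.
Proof.
elim: N a => [|N IH] a NB.
  rewrite (big_pred1 [ffun=> ord0]) => [|k] /=.
    rewrite fact0 big1 => [|i _]; last by rewrite ffunE.
    by rewrite big1 => [|i _]; rewrite ?ffunE ?expr0// mulr1 divn1 mul1n addn0.
  rewrite sum_nat_eq0; apply/forallP/eqP => [H|-> i]; last by rewrite ffunE.
  by apply/ffunP => i; rewrite ffunE; apply/val_inj/eqP; exact: (H i).
rewrite -[stick_lengths _ _ _ N.+1]/(cut m p (stick_lengths m p L N)) count_cut.
pose inc (i : 'I_m) (k : {ffun 'I_m -> 'I_B.+1}) : {ffun 'I_m -> 'I_B.+1} :=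
  [ffun j => if j == i then inord (k j).+1 else k j].
pose dec (i : 'I_m) (k : {ffun 'I_m -> 'I_B.+1}) : {ffun 'I_m -> 'I_B.+1} :=
  [ffun j => if j == i then inord (k j).-1 else k j].
have kle i (k : {ffun 'I_m -> 'I_B.+1}) : (k i <= \sum_j k j)%N.
  by rewrite (bigD1 i)//= leq_addr.
have decE i k : dec i k i = (k i).-1 :> nat.
  by rewrite ffunE eqxx inordK// (leq_ltn_trans (leq_pred _)).
have decN i j k : j != i -> dec i k j = k j by move=> ji; rewrite ffunE (negbTE ji).
transitivity (\sum_(i < m) \sum_(k : {ffun 'I_m -> 'I_B.+1}
    | (\sum_j k j == N.+1) && (0 < k i))
    (N`! %/ \prod_j (dec i k j)`!) * a (L * \prod_(j < m) p j.+1 ^+ k j)%R)%N.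
  apply: eq_bigr => i _; rewrite IH; last exact: ltnW.
  have sumdec (k : {ffun 'I_m -> 'I_B.+1}) : (0 < k i)%N ->
      (\sum_j k j = (\sum_j dec i k j).+1)%N.
    move=> k0; rewrite (bigD1 i)//= [in RHS](bigD1 i)//= decE -addSn prednK//.
    by congr addn; apply: eq_bigr => j ji; rewrite decN.
  rewrite (reindex_onto (dec i) (inc i)) /=; last first.
    move=> k /eqP ks; apply/ffunP => j; rewrite !ffunE.
    case: eqP => // ->; apply/val_inj; rewrite /= !inordK//=.
    - by rewrite ltnS (leq_trans _ NB)// ltnS -ks.
    - by rewrite ltnS (leq_trans _ NB)// ltnS -ks.
  apply: eq_big => [k|k /andP[/eqP ks /eqP ik]].
    apply/andP/andP => [[/eqP ks /eqP ik]|[/eqP ks k0]].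
      have k0 : (0 < k i)%N.
        rewrite -ik ffunE eqxx inordK//.
        by rewrite ltnS (leq_trans _ NB)// ltnS -ks.
      by rewrite sumdec// ks.
    split; first by move: ks; rewrite sumdec// => -[->].
    apply/eqP/ffunP => j; rewrite ffunE; case: eqP => [->|/eqP ji]; last by rewrite decN.
    by apply/val_inj; rewrite /= decE prednK// inordK.
  congr (_ * _)%N; congr (nat_of_bool (a _)).
  have k0 : (0 < k i)%N.
    rewrite -ik ffunE eqxx inordK//.
    by rewrite ltnS (leq_trans _ NB)// ltnS -ks.
  rewrite mulrCA; congr (L * _).
  rewrite (bigD1 i)//= [in RHS](bigD1 i)//= decE mulrA -exprS prednK//.
  by congr (_ * _); apply: eq_bigr => j ji; rewrite decN.
rewrite (exchange_big_dep (fun k : {ffun 'I_m -> 'I_B.+1} => \sum_j k j == N.+1)%N) /=;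
  last by move=> i k _ /andP[].
apply: eq_bigr => k /eqP ks; rewrite ks eqxx -big_distrl /=; congr (_ * _)%N.
set P := (\prod_i (k i)`!)%N.
have P0 : (0 < P)%N by rewrite prodn_gt0// => i; rewrite fact_gt0.
have PN : (P %| (N.+1)`!)%N by rewrite -ks; exact: dvdn_prod_fact.
apply/eqP; rewrite -(eqn_pmul2r P0) divnK// factS -{1}ks !big_distrl/=.
rewrite [in X in X == _]big_mkcond/=; apply/eqP/eq_bigr => i _.
case: posnP => [->|k0]; first by rewrite mul0n.
have -> : P = (k i * \prod_j (dec i k j)`!)%N.
  rewrite /P (bigD1 i)//= [in RHS](bigD1 i)//= decE mulnA -{1 2}(prednK k0) factS prednK//.
  by congr muln; apply: eq_bigr => j ji; rewrite decN.
rewrite mulnCA divnK//.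
suff -> : N = (\sum_j dec i k j)%N by exact: dvdn_prod_fact.
apply: succn_inj; rewrite -ks (bigD1 i)//= [in RHS](bigD1 i)//= decE -addSn prednK//.
by congr addn; apply: eq_bigr => j ji; rewrite decN.
Qed.

Lemma count_stick_lengths (R : realType) m (p : nat -> R) (L : R) N
    (a : pred R) :
  count a (stick_lengths m p L N) =
  (\sum_(k : {ffun 'I_m -> 'I_N.+1} | \sum_i k i == N)
     (N`! %/ \prod_i (k i)`!) * a (L * \prod_(i < m) p i.+1 ^+ k i)%R)%N.
Proof. exact: count_stick_lengths_bound. Qed.

Lemma random_stick_law (R : realType) m (p : nat -> R) (L : R) N (a : pred R) :
  (0 < m)%N ->
  uniform_nat R (m ^ N) [set j | a (random_stick m p L N j)] =
  ((count a (stick_lengths m p L N))%:R / (m ^ N)%:R)%:E.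
Proof.
move=> m0; rewrite uniform_natE ?expn_gt0 ?m0//; congr ((_%:R / _)%:E).
rewrite -sum1_count (big_nth L) size_stick_lengths big_mkord [RHS]big_mkcond/=.
apply: eq_bigr => i _; rewrite -[if _ then _ else _]/(nat_of_bool _).
by congr nat_of_bool; apply/idP/idP => [|?]; rewrite inE.
Qed.

(* Main.v *)
Require Import Defs.
From mathcomp Require Import all_boot all_order all_algebra.
From mathcomp Require Import all_classical all_reals all_analysis.
From mathcomp Require Import ring lra zify.
Import Order.TTheory GRing.Theory Num.Theory.
Import numFieldNormedType.Exports.
Local Open Scope classical_set_scope.
Local Open Scope ring_scope.

(** Why the theorem holds.  Write u for the base 10 logarithm of the length of
    a stick.  The significand of a stick is at most s exactly when the
    fractional part of u is at most the logarithm of s, so strong Benford's law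
    says that u becomes equidistributed modulo 1
    ([strong_benford_sticksP]).

    An irrational y_i forces equidistribution.  The logarithm u is a random
    walk whose steps are the logarithms of the proportions.  The law of a stick
    does not notice, in the limit, an exchange of one cut by p_i for one cut by
    p_j: the means of g (p_i l) and g (p_j l) differ by a quantity that tends
    to 0 ([stick_mean_weighted_cvg0]).  The reason is exchangeability of the
    steps.  If k is the number of cuts by p_i minus the number of cuts by p_j
    among the N + 1 first stages, then the mean of k * g at stage N + 1 is
    (N + 1) / m times the difference of means at stage N, while k is a sum of
    N + 1 centred independent steps and so is only of the order of the square
    root of N.

    Consequently the shifts of u which become invisible to 1-periodic functions
    form an additive subgroup of the line that contains 1 and all the y_i
    ([asymptotic_period_ratio]); it is dense as soon as some y_i is irrational
    ([subgroup_dense]).  For a shift d in [0, 1], the indicator of the arc where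
    the fractional part {u} is less than d equals
    floor u - floor (u - d) = d + {u - d} - {u}.  So when d is an asymptotic
    period, the mean of this indicator tends to d, because {.} is bounded and
    periodic.  Arcs of arbitrary width t are squeezed between arcs whose widths
    are asymptotic periods ([stick_mean_frac_cvg]).

    If all the y_i are rational, there is Q > 0 such that at each stage the
    numbers Q * u agree modulo 1 for all sticks ([log10_stick_coset]).  Then
    {u} takes values in one coset of the multiples of 1 / Q, which may rotate
    with N, and cannot meet both of the arcs (0, 1 / 2Q] and (1 / 2Q, 1 / Q].
    The product of the proportions of sticks in these arcs is 0 at every stage,
    whereas equidistribution would make it tend to 1 / 4Q^2. *)

(** * Sums and means over the sticks *)

Definition stick_mean {R : realType} (m : nat) (p : nat -> R) (L : R) (N : nat)
    (f : R -> R) : R :=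
  (\sum_(l <- stick_lengths m p L N) f l) / (m ^ N)%:R.

Lemma sum_stick_lengthsS (R : realType) m (p : nat -> R) L N (f : R -> R) :
  \sum_(l <- stick_lengths m p L N.+1) f l =
  \sum_(l <- stick_lengths m p L N) \sum_(i <- iota 1 m) f (p i * l).
Proof. exact: big_allpairs_dep. Qed.

Lemma stick_length_gt0 (R : realType) m (p : nat -> R) L N l : 0 < L ->
  (forall i, (1 <= i <= m)%N -> 0 < p i) ->
  l \in stick_lengths m p L N -> 0 < l.
Proof.
move=> L0 p0; elim: N l => [|N IH] l; first by rewrite inE => /eqP ->.
move=> /allpairsP[[l' i]] /= [l'N]; rewrite mem_iota add1n ltnS => im ->.
by apply: mulr_gt0; [exact: p0|exact: IH].
Qed.

Lemma eq_stick_mean (R : realType) m (p : nat -> R) L N (f g : R -> R) :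
  {in stick_lengths m p L N, f =1 g} ->
  stick_mean m p L N f = stick_mean m p L N g.
Proof. by move=> fg; congr (_ / _); exact: eq_big_seq. Qed.

Lemma stick_meanD (R : realType) m (p : nat -> R) L N (f g : R -> R) :
  stick_mean m p L N (fun l => f l + g l) =
  stick_mean m p L N f + stick_mean m p L N g.
Proof. by rewrite /stick_mean big_split mulrDl. Qed.

Lemma stick_meanN (R : realType) m (p : nat -> R) L N (f : R -> R) :
  stick_mean m p L N (fun l => - f l) = - stick_mean m p L N f.
Proof. by rewrite /stick_mean sumrN mulNr. Qed.

Lemma stick_mean_cst (R : realType) m (p : nat -> R) L N (c : R) :
  (0 < m)%N -> stick_mean m p L N (fun=> c) = c.
Proof.
move=> m0; rewrite /stick_mean big_const_seq count_predT size_stick_lengths.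
by rewrite iter_addr_0 -[c *+ _]mulr_natr mulfK// pnatr_eq0 -lt0n expn_gt0 m0.
Qed.

Lemma le_stick_mean (R : realType) m (p : nat -> R) L N (f g : R -> R) :
  {in stick_lengths m p L N, forall l, f l <= g l} ->
  stick_mean m p L N f <= stick_mean m p L N g.
Proof.
move=> fg; rewrite /stick_mean ler_wpM2r ?invr_ge0 ?ler0n//.
by rewrite big_seq [leRHS]big_seq; apply: ler_sum => l; exact: fg.
Qed.

Lemma stick_mean_pred (R : realType) m (p : nat -> R) L N (a : pred R) :
  stick_mean m p L N (fun l => (a l)%:R) =
  (count a (stick_lengths m p L N))%:R / (m ^ N)%:R.
Proof.
rewrite /stick_mean -sum1_count natr_sum [in RHS]big_mkcond/=; congr (_ / _).
by apply: eq_bigr => l _; case: (a l).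
Qed.

(** * Asymptotic invariance of the sticks *)

(** A mark in the second component adds up the weights [w i] of all the cuts
    that led to the stick. *)
Definition marked_sticks {R : realType} (m : nat) (p w : nat -> R) (L : R)
    (N : nat) : seq (R * R) :=
  iter N (fun s => [seq (p i * x.1, x.2 + w i) | x <- s, i <- iota 1 m])
    [:: (L, 0)].

Lemma size_marked_sticks (R : realType) m (p w : nat -> R) L N :
  size (marked_sticks m p w L N) = (m ^ N)%N.
Proof.
elim: N => //= N IH.
by rewrite size_allpairs -/(marked_sticks _ _ _ _ _) IH size_iota expnSr.
Qed.

Lemma sum_marked_sticksS (R : realType) m (p w : nat -> R) L N
    (f : R * R -> R) :
  \sum_(x <- marked_sticks m p w L N.+1) f x =
  \sum_(x <- marked_sticks m p w L N)
    \sum_(i <- iota 1 m) f (p i * x.1, x.2 + w i).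
Proof. exact: big_allpairs_dep. Qed.

Lemma sum_marked_sticks_fst (R : realType) m (p w : nat -> R) L N
    (f : R -> R) :
  \sum_(x <- marked_sticks m p w L N) f x.1 =
  \sum_(l <- stick_lengths m p L N) f l.
Proof.
elim: N f => [|N IH] f; first by rewrite !big_seq1.
by rewrite sum_marked_sticksS sum_stick_lengthsS -IH.
Qed.

(** Exchangeability of the cuts: each of the [N.+1] cuts contributes its weight
    to the mark, and all the contributions have the same sum because the order
    of the cuts does not matter for the length.  The induction peels off the
    last cut; multiplications by [p i] and [p j] commute, which turns the
    induction hypothesis at stage [N] into the contribution of the other
    cuts. *)
Lemma sum_mark_mul (R : realType) m (p w : nat -> R) L N (g : R -> R) :
  \sum_(x <- marked_sticks m p w L N.+1) x.2 * g x.1 =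
  N.+1%:R * \sum_(l <- stick_lengths m p L N)
    \sum_(i <- iota 1 m) w i * g (p i * l).
Proof.
have E n f : \sum_(x <- marked_sticks m p w L n.+1) x.2 * f x.1 =
    \sum_(x <- marked_sticks m p w L n)
      x.2 * (\sum_(i <- iota 1 m) f (p i * x.1)) +
    \sum_(l <- stick_lengths m p L n)
      \sum_(i <- iota 1 m) w i * f (p i * l).
  rewrite sum_marked_sticksS -(@sum_marked_sticks_fst _ _ _ w) -big_split /=.
  apply: eq_bigr => x _; rewrite mulr_sumr -big_split /=.
  by apply: eq_bigr => i _; rewrite mulrDl.
elim: N g => [|N IH] g.
  by rewrite E big_seq1 mul0r add0r mul1r.
rewrite E (IH (fun x => \sum_(i <- iota 1 m) g (p i * x))).
rewrite -[in RHS]natr1 mulrDl mul1r; congr (_ * _ + _).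
rewrite sum_stick_lengthsS; apply: eq_bigr => l _.
rewrite exchange_big /=; apply: eq_bigr => i _; rewrite mulr_sumr.
by apply: eq_bigr => j _; rewrite mulrCA.
Qed.

(** The variance of a sum of independent centred steps is additive: the cross
    terms vanish since the weights have sum 0. *)
Lemma sum_mark_sqr (R : realType) m (p w : nat -> R) L N :
  \sum_(i <- iota 1 m) w i = 0 ->
  \sum_(x <- marked_sticks m p w L N.+1) x.2 ^+ 2 =
  N.+1%:R * (m ^ N)%:R * \sum_(i <- iota 1 m) w i ^+ 2.
Proof.
move=> w0; set W := \sum_(i <- _) w i ^+ 2.
have E n : \sum_(x <- marked_sticks m p w L n.+1) x.2 ^+ 2 =
    m%:R * \sum_(x <- marked_sticks m p w L n) x.2 ^+ 2 + (m ^ n)%:R * W.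
  rewrite sum_marked_sticksS /= mulr_sumr.
  have -> : (m ^ n)%:R * W = \sum_(x <- marked_sticks m p w L n) W.
    by rewrite big_const_seq count_predT size_marked_sticks iter_addr_0 mulr_natl.
  rewrite -big_split/=; apply: eq_bigr => x _.
  under eq_bigr do rewrite sqrrD.
  have xw0 : \sum_(i <- iota 1 m) x.2 * w i = 0 by rewrite -mulr_sumr w0 mulr0.
  rewrite !big_split/= -/W xw0 !addr0.
  by rewrite big_const_seq count_predT size_iota iter_addr_0 mulr_natl.
elim: N => [|N IH]; first by rewrite E big_seq1/= expr0n/= mulr0 add0r expn0 !mul1r.
by rewrite E IH -natr1 expnS natrM; ring.
Qed.

(** By exchangeability the mean is [m / N.+1] times that of mark times [g] at
    the next stage, and marks have standard deviation of the order of
    [sqrt N].  The instance with weight 1 at [i] and -1 at [j] says that cuts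
    by [p i] and by [p j] become indistinguishable. *)
Lemma stick_mean_weighted_cvg0 (R : realType) m (p w : nat -> R) L
    (g : R -> R) : (0 < m)%N ->
  \sum_(i <- iota 1 m) w i = 0 -> (forall x, `|g x| <= 1) ->
  stick_mean m p L N (fun l => \sum_(i <- iota 1 m) w i * g (p i * l))
    @[N --> \oo] --> (0 : R).
Proof.
move=> m0 w0 g1; set W := \sum_(i <- iota 1 m) w i ^+ 2.
have W0 : 0 <= W by apply: sumr_ge0 => i _; rewrite sqr_ge0.
(* Instead of the Cauchy-Schwarz inequality, |d| <= d^2 / c + c with a free
   parameter c: the first term of the bound is made small by taking c large,
   the second one by then letting N tend to infinity. *)
have bound (c : R) N : 0 < c ->
    `|stick_mean m p L N (fun l => \sum_(i <- iota 1 m) w i * g (p i * l))| <=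
    W / c + c * m%:R / N.+1%:R.
  move=> c0.
  have mN : 0 < (m ^ N)%:R :> R by rewrite ltr0n expn_gt0 m0.
  have N0 : 0 < N.+1%:R :> R by rewrite ltr0n.
  have := sum_mark_mul R m p w L N g.
  rewrite /stick_mean; set S := \sum_(l <- stick_lengths _ _ _ N) _ => SE.
  rewrite normf_div (gtr0_norm mN) ler_pdivrMr//.
  rewrite -(ler_pM2l N0) -[X in X * `|_|](ger0_norm (ltW N0)) -normrM -SE.
  apply: (le_trans (ler_norm_sum _ _ _)).
  apply: (@le_trans _ _
      (\sum_(x <- marked_sticks m p w L N.+1) (x.2 ^+ 2 / c + c))).
    apply: ler_sum => x _; rewrite normrM.
    apply: (@le_trans _ _ `|x.2|); first by rewrite ler_piMr.
    rewrite -(ler_pM2r c0) mulrDl divfK ?gt_eqF// -[_ ^+ 2]real_normK ?num_real//.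
    have : 0 <= `|x.2| by [].
    by move: `|x.2| => y y0; nra.
  have := size_marked_sticks R m p w L N.+1; have := sum_mark_sqr R m p w L N w0.
  move: (marked_sticks m p w L N.+1) => s; rewrite -/W => sE sizeE.
  rewrite big_split/= -mulr_suml sE big_const_seq count_predT sizeE.
  rewrite iter_addr_0 -[c *+ _]mulr_natr expnS natrM.
  rewrite le_eqVlt; apply/orP; left; apply/eqP; field.
  by rewrite nat1r !gt_eqF.
apply/cvgr0Pnorm_lt => e e0.
pose c := 2 * W / e + 1.
have c0 : 0 < c by rewrite ltr_wpDl// divr_ge0// ?mulr_ge0// ltW.
near=> N; apply: le_lt_trans (bound c N c0) _.
rewrite [ltRHS](splitr e) ltrD//.
  rewrite ltr_pdivrMr// /c mulrDr mulr1.
  have -> : e / 2 * (2 * W / e) = W by field; rewrite gt_eqF.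
  by rewrite ltrDl divr_gt0.
rewrite ltr_pdivrMr// -ltr_pdivrMl ?divr_gt0//.
near: N; have := @nbhs_infty_ger R ((e / 2)^-1 * (c * m%:R)).
apply: filterS => N NE; apply: le_lt_trans NE _.
by rewrite ltr_nat.
Unshelve. all: by end_near.
Qed.

(** * Fractional parts and dense subgroups of the line *)

Definition frac_part {R : realType} (u : R) : R := u - (Num.floor u)%:~R.

Lemma frac_itv (R : realType) (u : R) : 0 <= frac_part u < 1.
Proof.
have /andP[h1 h2] := Num.Theory.floor_itv u.
by rewrite /frac_part subr_ge0 h1 ltrBlDl -intrD1.
Qed.

Lemma fracDz (R : realType) (u : R) (k : int) : frac_part (u + k%:~R) = frac_part u.
Proof.
rewrite /frac_part Num.Theory.floorDrz ?intr_int// intrKfloor rmorphD /=.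
by rewrite opprD addrACA subrr addr0.
Qed.

Lemma frac_id (R : realType) (u : R) : 0 <= u < 1 -> frac_part u = u.
Proof. by move=> u01; rewrite /frac_part (@floor_def _ _ 0) ?subr0. Qed.

Lemma subgroup_mulrz (R : realType) (G : set R) :
  G 0 -> (forall x y, G x -> G y -> G (x - y)) ->
  forall x (k : int), G x -> G (x *~ k).
Proof.
move=> G0 GB x k Gx.
have GN y : G y -> G (- y) by rewrite -sub0r; exact: GB.
have Gn n : G (x *+ n).
  elim: n => [|n IH]; first by rewrite mulr0n.
  by rewrite mulrSr -[x in _ + x]opprK; apply/GB/GN.
by case: k => n; [exact: Gn|rewrite NegzE mulrNz; exact/GN/Gn].
Qed.

(** One Euclidean step: 1 and [y] cannot both be multiples of [d], so one of them
    leaves a remainder strictly between 0 and [d], and either this remainder or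
    its complement to [d] is at most [d / 2]. *)
Lemma subgroup_halve (R : realType) (G : set R) (y : R) :
  G 0 -> (forall x z, G x -> G z -> G (x - z)) -> G 1 -> G y ->
  irrational y ->
  forall d, 0 < d -> G d -> exists2 e, G e & 0 < e <= d / 2.
Proof.
move=> G0 GB G1 Gy yirr d d0 Gd.
have [x Gx xd] : exists2 x, G x & forall k : int, x != d *~ k.
  apply: contrapT => /forall2NP noncomm.
  have mult x : G x -> exists k : int, x = d *~ k.
    move=> Gx; case: (noncomm x) => // /existsNP[k].
    by move=> /negP; rewrite negbK => /eqP ->; exists k.
  have [k k1] := mult _ G1; have [l yl] := mult _ Gy.
  have kn0 : k != 0.
    by apply: contra_eq_neq k1 => ->; rewrite mulr0z oner_neq0.
  apply: yirr; exists (l%:~R / k%:~R) => //.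
  rewrite fmorph_div/= !ratr_int yl.
  have kd : d * k%:~R = 1 by rewrite mulrzr.
  have kR : k%:~R != 0 :> R by rewrite intr_eq0.
  by apply: (mulIf kR); rewrite divfK// -(mulrzr d) mulrAC kd mul1r.
pose r := x - d *~ Num.floor (x / d).
have Gr : G r := GB _ _ Gx (subgroup_mulrz R G G0 GB d _ Gd).
have /andP[r0 rd] : 0 < r < d.
  rewrite lt_neqAle eq_sym subr_eq0 xd /r -mulrzr /=.
  have /andP[h1 h2] := Num.Theory.floor_itv (x / d).
  rewrite subr_ge0 mulrC -ler_pdivlMr// h1/= ltrBlDl -[X in _ + X]mul1r.
  by rewrite -mulrDl -ltr_pdivrMr// -intrD1.
have [rle|rgt] := leP r (d / 2); first by exists r; rewrite ?r0.
by exists (d - r); [exact: GB|rewrite subr_gt0 rd; lra].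
Qed.

(** Halving produces arbitrarily small positive elements, whose multiples cannot
    jump over an interval. *)
Lemma subgroup_dense (R : realType) (G : set R) (y : R) :
  G 0 -> (forall x z, G x -> G z -> G (x - z)) -> G 1 -> G y ->
  irrational y ->
  forall a b, a < b -> exists2 d, G d & a < d < b.
Proof.
move=> G0 GB G1 Gy yirr a b ab.
have small n : exists2 d, G d & 0 < d <= 2^-1 ^+ n.
  elim: n => [|n [d Gd /andP[d0 dn]]]; first by exists 1; rewrite ?expr0 ?ltr01 /=.
  have [e Ge /andP[e0 ed]] := subgroup_halve R G y G0 GB G1 Gy yirr d d0 Gd.
  by exists e; rewrite // e0 (le_trans ed)// exprSr ler_pM2r// invr_gt0.
have [n nab] : exists n, 2^-1 ^+ n < b - a.
  have /cvgr0Pnorm_lt/(_ (b - a)) : ((2^-1 : R) ^+ n) @[n --> \oo] --> (0 : R).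
    by apply: cvg_expr; rewrite ger0_norm ?invr_ge0// invf_lt1// ltr1n.
  rewrite subr_gt0 => /(_ ab)[n _ /(_ n (leqnn n))/=].
  by rewrite ger0_norm ?exprn_ge0 ?invr_ge0//; exists n.
have [d Gd /andP[d0 dn]] := small n.
have /andP[h1 h2] := Num.Theory.floor_itv (a / d).
exists (d *~ (Num.floor (a / d) + 1)); first exact: (subgroup_mulrz R G G0 GB).
rewrite -mulrzr mulrC -ltr_pdivrMr// h2/= intrD mulrDl mul1r.
rewrite ler_pdivlMr// in h1; move: (le_lt_trans dn nab) h1.
by move=> db fa; apply: le_lt_trans (_ : a + d < b); [rewrite lerD2r|lra].
Qed.

(** * Significands as fractional parts of logarithms *)

Lemma ln10_gt0 (R : realType) : 0 < ln 10 :> R.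
Proof. by rewrite ln_gt0// ltr1n. Qed.

Lemma log10M (R : realType) (x y : R) : 0 < x -> 0 < y ->
  log10 (x * y) = log10 x + log10 y.
Proof. by move=> x0 y0; rewrite /log10 lnM ?posrE// mulrDl. Qed.

Lemma log10_div (R : realType) (x y : R) : 0 < x -> 0 < y ->
  log10 (x / y) = log10 x - log10 y.
Proof. by move=> x0 y0; rewrite /log10 ln_div ?posrE// mulrBl. Qed.

Lemma ler_log10 (R : realType) (x y : R) : 0 < x -> 0 < y ->
  (log10 x <= log10 y) = (x <= y).
Proof.
move=> x0 y0.
by rewrite /log10 ler_pM2r ?invr_gt0 ?ln10_gt0// ler_ln ?posrE. Qed.

Lemma log10_powR (R : realType) (t : R) : log10 (10 `^ t) = t.
Proof. by rewrite /log10 ln_powR mulfK// gt_eqF// ln10_gt0. Qed.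

Lemma log10_1 (R : realType) : log10 1 = 0 :> R.
Proof. by rewrite /log10 ln1 mul0r. Qed.

Lemma log10_10 (R : realType) : log10 10 = 1 :> R.
Proof. by rewrite /log10 mulfV// gt_eqF// ln10_gt0. Qed.

Lemma log10_significand (R : realType) (x : R) : 0 < x ->
  log10 (significand x) = frac_part (log10 x).
Proof.
move=> x0; have [/andP[S1 S10] [k xE]] := significandP x0.
have S0 : 0 < significand x := lt_le_trans ltr01 S1.
have k0 : 0 < (10 : R) ^ k by rewrite exprz_gt0.
rewrite [in RHS]xE log10M//.
have -> : log10 (10 ^ k : R) = k%:~R by rewrite -powR_intmul// log10_powR.
rewrite fracDz frac_id// -[X in X <= _]log10_1 ler_log10// S1/=.
rewrite -[ltRHS]log10_10 ltNge ler_log10//.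
by rewrite -ltNge.
Qed.

Lemma strong_benford_sticksP (R : realType) (m : nat) (p : nat -> R) (L : R) :
  (0 < m)%N -> 0 < L -> (forall i, (1 <= i <= m)%N -> 0 < p i) ->
  strong_benford (fun N => random_stick m p L N) <->
  forall t : R, 0 <= t <= 1 ->
    stick_mean m p L N (fun l => (frac_part (log10 l) <= t)%R%:R)
      @[N --> \oo] --> t.
Proof.
move=> m0 L0 p0.
have E (s : R) N : 0 < s ->
    uniform_nat R (m ^ N) [set w | significand (random_stick m p L N w) <= s] =
    (stick_mean m p L N (fun l => (frac_part (log10 l) <= log10 s)%R%:R))%:E.
  move=> s0; have := @random_stick_law R m p L N (fun l => significand l <= s) m0.
  move=> ->; rewrite -(stick_mean_pred _ _ _ _ _ (fun l => significand l <= s)).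
  congr EFin; apply: eq_stick_mean => l lN; congr _%:R.
  have l0 := stick_length_gt0 _ _ _ _ _ _ L0 p0 lN.
  have [/andP[S1 _] _] := significandP l0.
  by rewrite -log10_significand// ler_log10// (lt_le_trans ltr01).
have Efun (s : R) : 0 < s ->
    (fun N => uniform_nat R (m ^ N)
      [set w | significand (random_stick m p L N w) <= s]) =
    EFin \o (fun N => stick_mean m p L N
      (fun l => (frac_part (log10 l) <= log10 s)%R%:R)).
  by move=> s0; apply/funext => N; exact: E.
split=> [H t /andP[t0 t1]|H s /andP[s1 s10]].
  have s0 : 0 < 10 `^ t :> R by rewrite powR_gt0.
  have s1 : (1 : R) <= 10 `^ t <= 10.
    by rewrite -(ler_log10 _ 1)// -(ler_log10 _ _ 10)//
      log10_powR log10_1 log10_10 t0.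
  move: (H _ s1). rewrite (Efun _ s0). rewrite log10_powR.
  by move=> /fine_cvgP[_].
have s0 : 0 < s := lt_le_trans ltr01 s1.
rewrite (Efun _ s0).
apply: cvg_EFin; first by near=> N.
apply: H.
have := s1; rewrite -(ler_log10 _ 1)// log10_1 => ->.
by move: s10; rewrite -(ler_log10 _ _ 10)// log10_10.
Unshelve. all: by end_near.
Qed.

(** * Equidistribution from an irrational ratio *)

(** Only 1-periodic test functions are used, so that 1 is itself a period and an
    irrational period generates, together with it, a dense group. *)
Definition asymptotic_period {R : realType} (m : nat) (p : nat -> R) (L : R)
    (d : R) : Prop :=
  forall h : R -> R, (forall u, h (u + 1) = h u) -> (forall u, `|h u| <= 1) ->
    stick_mean m p L N (fun l => h (log10 l + d) - h (log10 l))
      @[N --> \oo] --> (0 : R).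

Lemma asymptotic_period0 (R : realType) m (p : nat -> R) L :
  asymptotic_period m p L 0.
Proof.
move=> h _ _.
under eq_fun do under [X in stick_mean _ _ _ _ X]eq_fun do rewrite addr0 subrr.
rewrite /stick_mean; under eq_fun do rewrite big1// mul0r.
exact: cvg_cst.
Qed.

Lemma asymptotic_period1 (R : realType) m (p : nat -> R) L :
  asymptotic_period m p L 1.
Proof.
move=> h h1 _.
under eq_fun do under [X in stick_mean _ _ _ _ X]eq_fun do rewrite h1 subrr.
rewrite /stick_mean; under eq_fun do rewrite big1// mul0r.
exact: cvg_cst.
Qed.

Lemma asymptotic_periodB (R : realType) m (p : nat -> R) L c d :
  asymptotic_period m p L c -> asymptotic_period m p L d ->
  asymptotic_period m p L (c - d).
Proof.
move=> Hc Hd h h1 hb.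
pose g u := h (u - d).
have g1 u : g (u + 1) = g u by rewrite /g addrAC h1.
have := cvgB (Hc g g1 (fun u => hb _)) (Hd g g1 (fun u => hb _)).
rewrite subr0 => Hcd; refine (cvg_trans _ (Hcd _)); apply: near_eq_cvg; near=> N.
rewrite /= -[LHS]/(_ - _) -stick_meanN -stick_meanD; apply: eq_stick_mean => l _.
by rewrite /g addrK addrA; ring.
Unshelve. all: by end_near.
Qed.

(** Applying the indistinguishability of cuts by [p i] and [p j] to
    [g x = h (log10 x - log10 (p j))] turns the cut by [p j] into the identity
    and the cut by [p i] into a shift by [log10 (p i / p j)]. *)
Lemma asymptotic_period_ratio (R : realType) m (p : nat -> R) L i j :
  0 < L -> (forall k, (1 <= k <= m)%N -> 0 < p k) ->
  (1 <= i <= m)%N -> (1 <= j <= m)%N ->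
  asymptotic_period m p L (log10 (p i / p j)).
Proof.
move=> L0 p0 im jm h h1 hb.
have m0 : (0 < m)%N by lia.
pose w k : R := (k == i)%:R - (k == j)%:R.
have sumE a (F : nat -> R) : (1 <= a <= m)%N ->
    \sum_(k <- iota 1 m) (k == a)%:R * F k = F a.
  move=> am; rewrite (bigD1_seq a) ?iota_uniq ?mem_iota ?add1n ?ltnS//=.
  rewrite eqxx mul1r big1 ?addr0// => k /negbTE ->; exact: mul0r.
have w0 : \sum_(k <- iota 1 m) w k = 0.
  rewrite sumrB; have S1 a : (1 <= a <= m)%N ->
      \sum_(k <- iota 1 m) (k == a)%:R = 1 :> R.
    move=> am; rewrite -[RHS](sumE a (fun=> 1) am).
    by apply: eq_bigr => k _; rewrite mulr1.
  by rewrite !S1 ?subrr.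
have := stick_mean_weighted_cvg0 R m p w L (fun x => h (log10 x - log10 (p j)))
  m0 w0 (fun x => hb _).
move=> Hg; refine (cvg_trans _ Hg); apply: near_eq_cvg; near=> N.
apply: eq_stick_mean => l lN.
have l0 := stick_length_gt0 _ _ _ _ _ _ L0 p0 lN.
under eq_bigr do rewrite mulrBl.
rewrite sumrB !sumE// log10_div ?p0// !log10M ?p0//.
by congr (h _ - h _); ring.
Unshelve. all: by end_near.
Qed.

(** The right-hand side is [floor u - floor (u - d)], a nonnegative integer that
    counts the integers in the interval from [u - d], excluded, to [u]. *)
Lemma frac_le_indicator_ub (R : realType) (u t d : R) : 0 <= t -> t < d ->
  (frac_part u <= t)%R%:R <= d + (frac_part (u - d) - frac_part u).
Proof.
move=> t0 td; have d0 := le_lt_trans t0 td.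
rewrite {2 3}/frac_part.
have -> : d + (u - d - (Num.floor (u - d))%:~R - (u - (Num.floor u)%:~R)) =
    (Num.floor u - Num.floor (u - d))%:~R.
  by rewrite rmorphB/=; ring.
rewrite -[_%:R]/((_ : nat)%:~R) ler_int.
have [ut|_] := leP (frac_part u) t.
  suff : Num.floor (u - d) < Num.floor u by rewrite /=; lia.
  by rewrite Num.Theory.floor_lt_int; move: ut td; rewrite /frac_part; lra.
rewrite subr_ge0 Num.Theory.floor_ge_int.
by rewrite (le_trans (Num.Theory.floor_le _))// gerBl ltW.
Qed.

(** The counterpart for a shift smaller than [t], possibly negative, in which
    case the integer [floor u - floor (u - d)] is at most 0. *)
Lemma frac_le_indicator_lb (R : realType) (u t d : R) : t <= 1 -> d < t ->
  d + (frac_part (u - d) - frac_part u) <= (frac_part u <= t)%R%:R.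
Proof.
move=> t1 dt; rewrite {1 2}/frac_part.
have -> : d + (u - d - (Num.floor (u - d))%:~R - (u - (Num.floor u)%:~R)) =
    (Num.floor u - Num.floor (u - d))%:~R.
  by rewrite rmorphB/=; ring.
rewrite -[_%:R]/((_ : nat)%:~R) ler_int.
have /andP[fl fu] := Num.Theory.floor_itv u.
have [ut|ut] := leP (frac_part u) t.
  suff : Num.floor u - 1 <= Num.floor (u - d) by rewrite /=; lia.
  by rewrite Num.Theory.floor_ge_int rmorphB/=; lra.
by rewrite subr_le0 Num.Theory.floor_ge_int; move: ut; rewrite /frac_part; lra.
Qed.

(** The two bounds on the indicator have means tending to [d] when [d] is an
    asymptotic period, and density provides such [d] on both sides of [t]. *)
Lemma stick_mean_frac_cvg (R : realType) m (p : nat -> R) L (y : R) :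
  (0 < m)%N -> asymptotic_period m p L y -> irrational y ->
  forall t : R, 0 <= t <= 1 ->
    stick_mean m p L N (fun l => (frac_part (log10 l) <= t)%R%:R)
      @[N --> \oo] --> t.
Proof.
move=> m0 yper yirr t /andP[t0 t1].
have dense := subgroup_dense R (asymptotic_period m p L) y
  (asymptotic_period0 R m p L) (@asymptotic_periodB R m p L)
  (asymptotic_period1 R m p L) yper yirr.
have mean d : asymptotic_period m p L d -> stick_mean m p L N
    (fun l => d + (frac_part (log10 l - d) - frac_part (log10 l)))
    @[N --> \oo] --> d.
  move=> dper.
  have Nd : asymptotic_period m p L (- d).
    by rewrite -sub0r; exact: asymptotic_periodB (asymptotic_period0 _ _ _ _) dper.
  have frac1 (u : R) : frac_part (u + 1) = frac_part u by exact: (fracDz _ u 1).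
  have fracb (u : R) : `|frac_part u| <= 1.
    by have /andP[? ?] := frac_itv R u; rewrite ger0_norm// ltW.
  have := cvgD (cvg_cst d) (Nd frac_part frac1 fracb).
  rewrite addr0 => Hd; refine (cvg_trans _ (Hd _ _)); apply: near_eq_cvg; near=> N.
  by rewrite [RHS]stick_meanD stick_mean_cst.
apply/cvgrPdist_lt => e e0.
have te : t < t + e by rewrite ltrDl.
have et : t - e < t by rewrite gtrBl.
have [d dper /andP[td dte]] := dense t (t + e) te.
have [c cper /andP[tc ct]] := dense (t - e) t et.
have /cvgrPdist_lt/(_ (t + e - d)) := mean d dper.
have /cvgrPdist_lt/(_ (c - (t - e))) := mean c cper.
rewrite !subr_gt0 => /(_ tc) nc /(_ dte) nd.
near=> N.
have ncN : `|c - stick_mean m p L N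
  (fun l => c + (frac_part (log10 l - c) - frac_part (log10 l)))| < c - (t - e).
  by near: N; exact: nc.
have ndN : `|d - stick_mean m p L N
  (fun l => d + (frac_part (log10 l - d) - frac_part (log10 l)))| < t + e - d.
  by near: N; exact: nd.
have ub : stick_mean m p L N (fun l => (frac_part (log10 l) <= t)%R%:R) <=
    stick_mean m p L N
      (fun l => d + (frac_part (log10 l - d) - frac_part (log10 l))).
  by apply: le_stick_mean => l _; exact: frac_le_indicator_ub.
have lb : stick_mean m p L N
    (fun l => c + (frac_part (log10 l - c) - frac_part (log10 l))) <=
    stick_mean m p L N (fun l => (frac_part (log10 l) <= t)%R%:R).
  by apply: le_stick_mean => l _; exact: frac_le_indicator_lb.
move: ncN ndN ub lb; rewrite !ltr_norml.
by move=> /andP[? ?] /andP[? ?] ? ?; apply/andP; split; lra.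
Unshelve. all: by end_near.
Qed.

(** * Failure of equidistribution for rational ratios *)

Lemma nirrational_mul_int (R : realType) (y : R) : ~ irrational y ->
  exists2 d : nat, (0 < d)%N & d%:R * y \is a Num.int.
Proof.
move=> /contrapT[q _ <-]; exists `|denq q|%N; first by rewrite absz_gt0 denq_neq0.
rewrite -[_%:R]/((_ : nat)%:~R) absz_denq /ratr mulrC divfK ?intr_int//.
by rewrite intr_eq0 denq_neq0.
Qed.

Lemma common_denominator (R : realType) (m : nat) (p : nat -> R) :
  (forall i, (1 <= i <= m)%N -> 0 < p i) ->
  (forall i, (1 <= i <= m - 1)%N -> ~ irrational (log10 (p i / p i.+1))) ->
  exists2 Q : nat, (0 < Q)%N &
    forall i, (1 <= i <= m)%N -> Q%:R * (log10 (p i) - log10 (p 1%N)) \is a Num.int.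
Proof.
move=> p0 rat; suff H n : (n <= m)%N -> exists2 Q : nat, (0 < Q)%N &
    forall i, (1 <= i <= n)%N -> Q%:R * (log10 (p i) - log10 (p 1%N)) \is a Num.int.
  by apply: H.
elim: n => [|n IH] nm; first by exists 1%N => // i; lia.
have [Q Q0 HQ] := IH (ltnW nm).
have [->|n0] := posnP n.
  exists 1%N => // i i1; have -> : i = 1%N by lia.
  by rewrite subrr mulr0 int_num0.
have n1 : (1 <= n <= m - 1)%N by lia.
have [d d0 Hd] := nirrational_mul_int _ _ (rat n n1).
exists (Q * d)%N; first by rewrite muln_gt0 Q0.
move=> i /andP[i1]; rewrite leq_eqVlt ltnS => /orP[/eqP ->|iN]; last first.
  rewrite natrM mulrAC rpredM ?natr_int// HQ//; exact/andP.
have -> : (Q * d)%:R * (log10 (p n.+1) - log10 (p 1%N)) =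
    d%:R * (Q%:R * (log10 (p n) - log10 (p 1%N))) -
    Q%:R * (d%:R * log10 (p n / p n.+1)).
  by rewrite log10_div ?p0 ?(ltnW nm) ?n0//= natrM; ring.
by rewrite rpredB// rpredM// ?natr_int// HQ// n0/=.
Qed.

(** Two sticks of the same stage differ by exchanges of cuts, each of which
    changes [Q * log10 l] by an integer.  The stages must agree, since
    [Q * log10 (p 1)] is arbitrary. *)
Lemma log10_stick_coset (R : realType) (m : nat) (p : nat -> R) (L Q : R) :
  0 < L -> (forall i, (1 <= i <= m)%N -> 0 < p i) ->
  (forall i, (1 <= i <= m)%N -> Q * (log10 (p i) - log10 (p 1%N)) \is a Num.int) ->
  forall N, {in stick_lengths m p L N &, forall l l',
    Q * (log10 l - log10 l') \is a Num.int}.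
Proof.
move=> L0 p0 HQ; elim=> [|N IH] l l'.
  by rewrite !inE => /eqP -> /eqP ->; rewrite subrr mulr0 int_num0.
move=> /allpairsP[[a i]] /= [aN]; rewrite mem_iota add1n ltnS => im ->.
move=> /allpairsP[[b j]] /= [bN]; rewrite mem_iota add1n ltnS => jm ->.
have a0 := stick_length_gt0 _ _ _ _ _ _ L0 p0 aN.
have b0 := stick_length_gt0 _ _ _ _ _ _ L0 p0 bN.
rewrite !log10M ?p0//.
have -> : Q * (log10 (p i) + log10 a - (log10 (p j) + log10 b)) =
    Q * (log10 (p i) - log10 (p 1%N)) - Q * (log10 (p j) - log10 (p 1%N)) +
    Q * (log10 a - log10 b) by ring.
by rewrite rpredD ?rpredB ?HQ ?IH.
Qed.

Lemma stick_mean_frac_neq (R : realType) (m : nat) (p : nat -> R) (L : R) N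
    (a b : R) : a <= b ->
  stick_mean m p L N (fun l => (frac_part (log10 l) <= a)%R%:R) !=
  stick_mean m p L N (fun l => (frac_part (log10 l) <= b)%R%:R) ->
  exists2 l, l \in stick_lengths m p L N & a < frac_part (log10 l) <= b.
Proof.
move=> ab; apply: contra_neqP => /forall2NP none.
apply: eq_stick_mean => l lN; congr (_%:R).
case: (none l) => // /negP; rewrite negb_and -leNgt -ltNge => /orP[fa|bf].
  by rewrite fa (le_trans fa ab).
by rewrite (lt_geF bf) (lt_geF (le_lt_trans ab bf)).
Qed.

(** Two values of the fractional part in the consecutive arcs (0, q] and
    (q, 2q], where 2q = 1 / Q, differ by less than 1 / Q without being equal,
    whereas values of sticks of the same stage differ by multiples of
    1 / Q; so the two arcs are never both occupied. *)
Lemma rational_ratios_not_equidistributed (R : realType) (m : nat)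
    (p : nat -> R) (L : R) :
  0 < L -> (forall i, (1 <= i <= m)%N -> 0 < p i) ->
  (forall i, (1 <= i <= m - 1)%N -> ~ irrational (log10 (p i / p i.+1))) ->
  ~ (forall t : R, 0 <= t <= 1 ->
    stick_mean m p L N (fun l => (frac_part (log10 l) <= t)%R%:R)
      @[N --> \oo] --> t).
Proof.
move=> L0 p0 rat; have [Q Q0 HQ] := common_denominator _ _ _ p0 rat.
pose F t N := stick_mean m p L N (fun l => (frac_part (log10 l) <= t)%R%:R).
pose q : R := (2 * Q%:R)^-1; move=> Fcvg.
have QR : 1 <= Q%:R :> R by rewrite ler1n.
have q0 : 0 < q by rewrite invr_gt0; lra.
have qQ : 2 * q * Q%:R = 1 by rewrite /q; field; lra.
have q1 : 2 * q <= 1 by nra.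
have c0 : F 0 @ \oo --> (0 : R) by apply: Fcvg; lra.
have c1 : F q @ \oo --> q by apply: Fcvg; lra.
have c2 : F (2 * q) @ \oo --> 2 * q by apply: Fcvg; lra.
have prodF : (F q N - F 0 N) * (F (2 * q) N - F q N) @[N --> \oo] -->
    (q - 0) * (2 * q - q).
  by apply: cvgM; exact: cvgB.
have prod0 N : (F q N - F 0 N) * (F (2 * q) N - F q N) = 0.
  apply/eqP; rewrite mulf_eq0 !subr_eq0 -implyNb.
  apply/implyP; rewrite eq_sym => /(stick_mean_frac_neq _ _ _ _ _ _ _ (ltW q0)).
  move=> [l lN /andP[l0 lq]]; rewrite eq_sym; apply: contraT.
  move=> /stick_mean_frac_neq[|l' lN' /andP[l'0 l'q]]; first by lra.
  have : Q%:R * (frac_part (log10 l') - frac_part (log10 l)) \is a Num.int.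
    rewrite /frac_part; set k := Num.floor _; set k' := Num.floor _.
    have -> : Q%:R * (log10 l' - k%:~R - (log10 l - k'%:~R)) =
        Q%:R * (log10 l' - log10 l) - Q%:R * (k - k')%:~R.
      by rewrite rmorphB/=; ring.
    apply: rpredB; last by rewrite rpredM ?natr_int ?intr_int.
    exact: (log10_stick_coset _ _ _ _ _ L0 p0 HQ N l' l lN' lN).
  move=> /intrP[z zE].
  have z0 : (0 : int) < z.
    by rewrite -(ltr0z R) -zE mulr_gt0// ?ltr0n// subr_gt0 (le_lt_trans lq).
  have z1 : z < (1 : int).
    rewrite -(ltr_int R) -zE [ltRHS](_ : _ = Q%:R * (2 * q)); last first.
      by rewrite mulrC qQ.
    by rewrite ltr_pM2l ?ltr0n// ltrBlDl; lra.
  by lia.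
have e : q * (2 * q - q) = 0.
  rewrite -[X in X * _]subr0; apply: (@cvg_unique _ (@Rhausdorff R)) prodF _.
  have -> : (fun N => (F q N - F 0 N) * (F (2 * q) N - F q N)) = (fun=> 0).
    by apply/funext.
  exact: cvg_cst.
have pos : 0 < q * (2 * q - q) by nra.
by rewrite e ltxx in pos.
Qed.

Theorem theorem1p1 (R : realType) (m : nat) (L : R) (p : nat -> R)
    (hm : (2 < m)%N) (hL : 0 < L)
    (hp : forall i : nat, (1 <= i <= m - 1)%N -> 0 < p i < 1)
    (hsum : \sum_(1 <= i < m) p i < 1)
    (hpm : p m = 1 - \sum_(1 <= i < m) p i) :
  strong_benford (fun N : nat => random_stick m p L N) <->
  exists i : nat, (1 <= i <= m - 1)%N /\ irrational (log10 (p i / p i.+1)).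
Proof.
have m0 : (0 < m)%N by lia.
have p0 i : (1 <= i <= m)%N -> 0 < p i.
  move=> /andP[i1]; rewrite leq_eqVlt => /orP[/eqP ->|im].
    by rewrite hpm subr_gt0.
  by have /andP[] : 0 < p i < 1 by apply: hp; lia.
rewrite strong_benford_sticksP//; split=> [equi|[i [im yirr]]].
  apply: contrapT => none; apply: rational_ratios_not_equidistributed equi => //.
  by move=> i im yirr; apply: none; exists i.
by apply: stick_mean_frac_cvg yirr => //; apply: asymptotic_period_ratio => //; lia.
Qed.
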